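(* Let $(X,\|\cdot\|)$ be a Banach space, $C\subseteq X$ a closed convex set, and $T:C\to C$ a nonexpansive map. Let $(\alpha_n)_{n\ge 1}$ be a sequence in $[0,1]$, $(e_n)_{n\ge 1}$ a sequence in $X$, $x_0\in C$, and let $(x_n)_{n\in\mathbb{N}}$ be generated by $$x_{n+1}=(1-\alpha_{n+1})\,x_n+\alpha_{n+1}\,(Tx_n+e_{n+1}),\qquad n\in\mathbb{N}.$$ Assume that there exists $\kappa\in[0,\infty)$ such that $x_n\in C$ and $\|Tx_n-x_0\|\le\kappa$ for all $n\in\mathbb{N}$. Let $\tau_n=\sum_{k=1}^n\alpha_k(1-\alpha_k)$ and suppose that $\tau_n\to\infty$ and $\|e_n\|=O((1-\alpha_n)/\tau_n^a)$ as $n\to\infty$. (a) If $\frac12\le a<1$ then $\|x_n-Tx_n\|=O(1/\tau_n^{a-1/2})$. (b) If $a=1$ then $\|x_n-Tx_n\|=O(\log\tau_n/\sqrt{\tau_n})$. (c) If $a>1$ then $\|x_n-Tx_n\|=O(1/\sqrt{\tau_n})$.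
   Context: $\mathbb{N}=\{0,1,2,\dots\}$. $T$ nonexpansive means $\|Tx-Ty\|\le\|x-y\|$ for all $x,y$ in its domain. All $O(\cdot)$ are as $n\to\infty$. *)

(* Defs.v *)
From mathcomp Require Import all_boot all_order all_algebra.
From mathcomp Require Import all_classical all_reals all_analysis.

Set Implicit Arguments.
Unset Strict Implicit.
Unset Printing Implicit Defensive.

Import Order.TTheory GRing.Theory Num.Theory.
Import numFieldNormedType.Exports.

Local Open Scope classical_set_scope.
Local Open Scope ring_scope.

(* A map T : C -> C is represented by a total function on X that maps C into
   itself; its values outside of C are arbitrary. *)
Definition self_map_on (X : Type) (C : set X) (T : X -> X) : Prop :=
  forall x, C x -> C (T x).

Definition nonexpansive_on (R : realType) (X : normedModType R) (C : set X)
    (T : X -> X) : Prop :=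
  forall x y, C x -> C y -> `|T x - T y| <= `|x - y|.

(* The sequences of step sizes and errors are indexed by n >= 1: their values
   at 0 are never used. *)
Definition tau (R : realType) (alpha : nat -> R) (n : nat) : R :=
  \sum_(1 <= k < n.+1) alpha k * (1 - alpha k).

Definition inexact_KM_iteration (R : realType) (X : normedModType R)
    (T : X -> X) (alpha : nat -> R) (e x : nat -> X) : Prop :=
  forall n, x n.+1 = (1 - alpha n.+1) *: x n
                     + alpha n.+1 *: (T (x n) + e n.+1).

(* Main.v *)
Require Import Defs.
From mathcomp Require Import all_boot all_order all_algebra.
From mathcomp Require Import all_classical all_reals all_analysis.
From mathcomp Require Import ring lra.
Import Order.TTheory GRing.Theory Num.Theory.
Import numFieldNormedType.Exports.
Local Open Scope classical_set_scope.
Local Open Scope ring_scope.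

Set Implicit Arguments.
Unset Strict Implicit.
Unset Printing Implicit Defensive.

(** For m <= n put D(m,n) = |x_m - x_n| and E(m,n) = |x_m - T x_n|, and let
    eps_k = alpha_k |e_k|.  Expanding one step of the iteration, either at the
    larger index or at the smaller one, and using nonexpansiveness gives
      D(m,n) <= (1 - alpha_n) D(m,n-1) + alpha_n E(m,n-1) + eps_n,
      E(m,n) <= (1 - alpha_m) E(m-1,n) + alpha_m D(m-1,n) + eps_m,
    with D(n,n) = 0 and E(0,n) <= kappa.  Without errors, this system is solved
    by D(m,n) = E[u_m(N)] and E(m,n) = E[u_m(1 + N)], where N is the sum of
    independent Bernoulli variables of parameters alpha_i, m < i <= n, and u is
    the solution of a discrete heat equation on the half line,
      u_m(p) = (1 - 2 q_m) u_{m-1}(p) + q_m (u_{m-1}(p+1) + u_{m-1}(p-1)),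
    with q_m = alpha_m (1 - alpha_m), u_m(0) = 0 and u_0(p) = kappa for p >= 1:
    up to the factor kappa, u_m(p) is the probability that a lazy random walk
    started at p stays positive.  The errors are accounted for by adding a
    source 2 eps_m to the heat equation, and any supersolution w of it, with
    w_m(0) >= 0 and w_0(p) >= kappa for p >= 1, yields |x_n - T x_n| <= w_n(1)
    ([distance_recursion_le]).

    The function 1 - max(0, 1 - p / sqrt(t + 1))^2 is an explicit supersolution
    ([survival_bound_step]) equal to 1 at t = 0, p >= 1, and at most
    2 / sqrt(t + 1) at p = 1.  Superposing its translates in time, one for each
    source, gives the estimate ([inexact_KM_residual_le])
      |x_n - T x_n| <= 2 kappa / sqrt(tau_n + 1)
                       + sum_{1 <= k <= n} 4 eps_k / sqrt(tau_n - tau_k + 1).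

    Since eps_k = O((tau_k - tau_{k-1}) / tau_k^a), the sum is controlled by the
    integral of t^(-a) (tau_n - t + 1)^(-1/2) over [1, tau_n].  Cutting at
    tau_n / 2 bounds it by a multiple of tau_n^(1/2 - a) plus
    tau_n^(-1/2) times the sum of (tau_k - tau_{k-1}) / tau_k^a
    ([inexact_KM_residual_asymp]); the latter sum is
    O(tau_n^(1 - a)), O(log tau_n) or O(1) according to the position of a with
    respect to 1. *)

(** * Averages over sums of Bernoulli variables *)

(** The expectation of f (p + b), for b a Bernoulli variable of parameter c. *)
Definition bern_avg (R : realType) (c : R) (f : nat -> R) (p : nat) : R :=
  (1 - c) * f p + c * f p.+1.

(** The expectation of f (p + N), for N a sum of independent Bernoulli variables
    of parameters alpha i, m < i <= m + k.  The fixpoint peels off the last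
    index m + k; [bern_sum_avg_recl] peels off the first one. *)
Fixpoint bern_sum_avg (R : realType) (alpha : nat -> R) (m k : nat)
    (f : nat -> R) : nat -> R :=
  if k is k'.+1
  then bern_avg (alpha (m + k)%N) (bern_sum_avg alpha m k' f)
  else f.

Lemma bern_avg_eq (R : realType) (c : R) (f g : nat -> R) (p : nat) :
  f =1 g -> bern_avg c f p = bern_avg c g p.
Proof. by move=> fg; rewrite /bern_avg !fg. Qed.

Lemma ler_bern_avg (R : realType) (c : R) (f g : nat -> R) (p : nat) :
  0 <= c <= 1 -> (forall i, f i <= g i) -> bern_avg c f p <= bern_avg c g p.
Proof.
move=> /andP[c0 c1] fg; rewrite /bern_avg.
by apply: lerD; apply: ler_wpM2l => //; rewrite subr_ge0.
Qed.

Lemma ler_bern_sum_avg (R : realType) (alpha : nat -> R) (m k : nat)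
    (f g : nat -> R) (p : nat) :
  (forall n : nat, (1 <= n)%N -> 0 <= alpha n <= 1) ->
  (forall i, f i <= g i) ->
  bern_sum_avg alpha m k f p <= bern_sum_avg alpha m k g p.
Proof.
move=> alpha01 fg; elim: k p => [|k IHk] p //=.
by apply: ler_bern_avg => //; apply: alpha01; rewrite addnS.
Qed.

Lemma bern_sum_avg_shift (R : realType) (alpha : nat -> R) (m k : nat)
    (f : nat -> R) (p : nat) :
  bern_sum_avg alpha m k (fun i => f i.+1) p = bern_sum_avg alpha m k f p.+1.
Proof. by elim: k p => [|k IHk] p //=; rewrite /bern_avg !IHk. Qed.

Lemma bern_sum_avg_affine (R : realType) (alpha : nat -> R) (m k : nat)
    (a b c : R) (f g : nat -> R) (p : nat) :
  bern_sum_avg alpha m k (fun i => a * f i + b * g i + c) p =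
  a * bern_sum_avg alpha m k f p + b * bern_sum_avg alpha m k g p + c.
Proof. by elim: k p => [|k IHk] p //=; rewrite /bern_avg !IHk; ring. Qed.

Lemma bern_sum_avg_cst (R : realType) (alpha : nat -> R) (m k : nat)
    (c : R) (p : nat) :
  bern_sum_avg alpha m k (fun=> c) p = c.
Proof. by elim: k p => [|k IHk] p //=; rewrite /bern_avg !IHk; ring. Qed.

Lemma bern_sum_avg_recl (R : realType) (alpha : nat -> R) (m k : nat)
    (f : nat -> R) (p : nat) :
  bern_sum_avg alpha m k.+1 f p =
  bern_sum_avg alpha m.+1 k (bern_avg (alpha m.+1) f) p.
Proof.
elim: k p => [|k IHk] p; first by rewrite /= addn1.
have -> : bern_sum_avg alpha m k.+2 f p =
    bern_avg (alpha (m + k.+2)%N) (bern_sum_avg alpha m k.+1 f) p by [].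
by rewrite (bern_avg_eq _ _ IHk) /= addSnnS.
Qed.

(** * The recursion for the distances along the iteration *)

Lemma ler_mix (R : realType) (c x y x' y' : R) : 0 <= c <= 1 ->
  x <= x' -> y <= y' -> (1 - c) * x + c * y <= (1 - c) * x' + c * y'.
Proof.
move=> /andP[c0 c1] xx yy.
by apply: lerD; apply: ler_wpM2l => //; rewrite subr_ge0.
Qed.

(** Comparison principle: w is a supersolution of the discrete heat equation
    with source 2 eps; the induction bounds D m n and E m n by averages of w m
    over p = N and p = 1 + N respectively, plus the sum of eps i, m < i <= n.
    In the step from m to m + 1, the Bernoulli variable of index m + 1 leaves N
    and, combined with the coin of the recursion for E, makes up one step of
    the lazy random walk. *)
Lemma distance_recursion_le (R : realType) (alpha eps : nat -> R)
    (D E w : nat -> nat -> R) (kappa : R) :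
  (forall n, (1 <= n)%N -> 0 <= alpha n <= 1) ->
  (forall n, (1 <= n)%N -> 0 <= eps n) ->
  (forall n, D n n <= 0) ->
  (forall m n, (m <= n)%N -> D m n.+1 <=
     (1 - alpha n.+1) * D m n + alpha n.+1 * E m n + eps n.+1) ->
  (forall n, E 0%N n <= kappa) ->
  (forall m n, (m < n)%N -> E m.+1 n <=
     (1 - alpha m.+1) * E m n + alpha m.+1 * D m n + eps m.+1) ->
  (forall m, 0 <= w m 0%N) ->
  (forall p, kappa <= w 0%N p.+1) ->
  (forall m p, (1 - 2 * (alpha m.+1 * (1 - alpha m.+1))) * w m p.+1 +
     alpha m.+1 * (1 - alpha m.+1) * (w m p.+2 + w m p) + 2 * eps m.+1
     <= w m.+1 p.+1) ->
  forall n, E n n <= w n 1%N.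
Proof.
move=> alpha01 eps0 D0 Drec E0 Erec w0 wkappa wrec.
pose S (m k : nat) : R := \sum_(i < k) eps (m + i.+1)%N.
have S_recr m k : S m k.+1 = S m k + eps (m + k.+1)%N.
  by rewrite /S big_ord_recr.
have S_recl m k : S m k.+1 = eps m.+1 + S m.+1 k.
  rewrite /S big_ord_recl addn1; congr (_ + _).
  by apply: eq_bigr => i _; rewrite /bump /= addSnnS.
have S_ge0 m k : 0 <= S m k.
  by apply: sumr_ge0 => i _; apply: eps0; rewrite addnS.
(* D m (m + k) is controlled as soon as E m (m + j) is, for j < k. *)
have D_of_E m :
    (forall k, E m (m + k)%N <= bern_sum_avg alpha m k (w m) 1%N + S m k) ->
    forall k, D m (m + k)%N <= bern_sum_avg alpha m k (w m) 0%N + S m k.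
  move=> Em; elim=> [|k IHk].
    by rewrite addn0 /S big_ord0 addr0 (le_trans (D0 m)) ?w0.
  rewrite S_recr addnS (le_trans (Drec _ _ (leq_addr k m)))// addrA lerD2r.
  have /ler_mix/(_ IHk (Em k)) := alpha01 (m + k).+1 isT.
  move=> /le_trans; apply.
  rewrite /= /bern_avg addnS.
  lra.
have E_le m : forall k,
    E m (m + k)%N <= bern_sum_avg alpha m k (w m) 1%N + S m k.
  elim: m => [|m IHm] k.
    rewrite add0n (le_trans (E0 k))// ler_wpDr//.
    rewrite -bern_sum_avg_shift.
    have <- : bern_sum_avg alpha 0 k (fun=> kappa) 0%N = kappa.
      exact: bern_sum_avg_cst.
    exact: ler_bern_sum_avg.
  have mk : (m < m.+1 + k)%N by rewrite addSn ltnS leq_addr.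
  rewrite (le_trans (Erec _ _ mk))// addSnnS.
  have /ler_mix/(_ (IHm k.+1) (D_of_E _ IHm k.+1)) := alpha01 m.+1 isT.
  rewrite -(lerD2r (eps m.+1)) => /le_trans; apply.
  rewrite S_recl !bern_sum_avg_recl.
  set f := bern_avg _ (w m); set B := bern_sum_avg alpha m.+1 k.
  have : B (fun i => (1 - alpha m.+1) * f i.+1 + alpha m.+1 * f i
             + 2 * eps m.+1) 0%N <= B (fun i => w m.+1 i.+1) 0%N.
    apply: ler_bern_sum_avg => // i; apply: le_trans (wrec m i).
    by rewrite /f /bern_avg; lra.
  rewrite /B bern_sum_avg_affine !bern_sum_avg_shift.
  lra.
by move=> n; have := E_le n 0%N; rewrite addn0 /S big_ord0 addr0.
Qed.

(** * A supersolution of the discrete heat equation *)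

(** The one-step inequality for the square of the positive part.  The second
    difference of this function with step d is at least d ^+ 2 on the
    positive half line, which beats its increase between x and y. *)
Lemma sqr_pos_part_step (R : realType) (q d x y : R) :
  0 <= q <= 1 / 4 -> 0 < d <= 1 -> x <= 1 ->
  y <= x + (1 - x) * (q * d ^+ 2 / 2) ->
  Num.max 0 y ^+ 2 <= (1 - 2 * q) * Num.max 0 x ^+ 2 +
    q * (Num.max 0 (x - d) ^+ 2 + Num.max 0 (x + d) ^+ 2).
Proof.
move=> /andP[q0 q4] /andP[d0 d1] x1 yx.
have h0 (z : R) : 0 <= Num.max 0 z by rewrite le_max lexx.
have h02 (z : R) : 0 <= Num.max 0 z ^+ 2 by rewrite exprn_ge0.
have q12 : 0 <= 1 - 2 * q by lra.
have hz (z : R) : z <= Num.max 0 z by rewrite le_max lexx orbT.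
have [y0|y0] := leP y 0.
  by rewrite expr0n/= addr_ge0// mulr_ge0// addr_ge0.
set c := q * d ^+ 2 / 2 in yx.
have d2 : 0 <= d ^+ 2 <= 1 by rewrite exprn_ge0 ?(ltW d0)//= expr_le1// ltW.
have c0 : 0 <= c by rewrite /c; nra.
have c8 : c <= 1 / 8 by rewrite /c; nra.
have [x0|x0] := leP 0 x.
  have y2 : y ^+ 2 <= x ^+ 2 + q * d ^+ 2.
    have -> : q * d ^+ 2 = 2 * c by rewrite /c; field.
    have y2 : y ^+ 2 <= (x + (1 - x) * c) ^+ 2.
      by rewrite lerXn2r// nnegrE; nra.
    have xx : c * (x * (1 - x)) <= c * (1 / 4).
      by apply: ler_wpM2l => //; have := sqr_ge0 (x - 1 / 2); lra.
    have x2 : c ^+ 2 * (1 - x) ^+ 2 <= c ^+ 2 * 1.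
      by apply: ler_wpM2l; rewrite ?sqr_ge0// expr_le1//; lra.
    have cc : c ^+ 2 <= c by rewrite expr2; nra.
    lra.
  have xd : (Num.max 0 (x + d)) ^+ 2 = (x + d) ^+ 2 by rewrite max_r//; lra.
  rewrite xd.
  have [xd0|xd0] := leP 0 (x - d).
    rewrite (le_trans y2)//; nra.
  rewrite (le_trans y2)// expr0n/= add0r.
  suff: 0 <= q * ((x + d) ^+ 2 - d ^+ 2 - 2 * x ^+ 2) by nra.
  by apply: mulr_ge0 => //; nra.
(* Here x < 0 < y, so x is within d / 2 of 0 and the x + d term dominates. *)
have xc : 0 < x + (1 - x) * c by exact: lt_le_trans yx.
have cd : c <= d / 8.
  have : d ^+ 2 <= d by rewrite expr2 ler_piMr// ltW.
  by rewrite /c; move: (d ^+ 2) d2 => z /andP[z0 z1] zd; nra.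
have yc : y <= c by nra.
have xd : d / 2 <= x + d by nra.
rewrite expr0n/= mulr0 add0r (max_l (_ : x - d <= 0)); last lra.
rewrite expr0n/= add0r (max_r (_ : 0 <= x + d)); last by lra.
have yc2 : y ^+ 2 <= c ^+ 2 by rewrite lerXn2r// nnegrE// ltW.
have xd2 : (d / 2) ^+ 2 <= (x + d) ^+ 2 by rewrite lerXn2r// nnegrE; lra.
have : q * (d / 2) ^+ 2 <= q * (x + d) ^+ 2 by exact: ler_wpM2l.
apply: le_trans; apply: (le_trans yc2).
have -> : q * (d / 2) ^+ 2 = c / 2 by rewrite /c; field.
by rewrite expr2; nra.
Qed.

(** An upper bound for the probability that a lazy random walk started at p,
    moving by 1 each way with probabilities q_i <= 1 / 4 of sum t, stays
    positive. *)
Definition survival_bound (R : realType) (p : nat) (t : R) : R :=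
  1 - Num.max 0 (1 - p%:R / Num.sqrt (t + 1)) ^+ 2.

Lemma sqrt_addr1_ge1 (R : realType) (t : R) : 0 <= t -> 1 <= Num.sqrt (t + 1).
Proof. by move=> t0; rewrite -[X in X <= _]sqrtr1 ler_wsqrtr// lerDr. Qed.

Lemma survival_bound0 (R : realType) (t : R) : survival_bound 0 t = 0.
Proof. by rewrite /survival_bound mul0r subr0 max_r// expr1n subrr. Qed.

Lemma survival_boundS_0 (R : realType) (p : nat) :
  survival_bound p.+1 (0 : R) = 1.
Proof.
by rewrite /survival_bound add0r sqrtr1 divr1 max_l ?expr0n/= ?subr0.
Qed.

Lemma survival_bound1_le (R : realType) (t : R) : 0 <= t ->
  survival_bound 1 t <= 2 / Num.sqrt (t + 1).
Proof.
move=> /sqrt_addr1_ge1 s1; rewrite /survival_bound div1r.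
have s1' : (Num.sqrt (t + 1))^-1 <= 1 by rewrite invf_le1// (lt_le_trans ltr01).
by rewrite max_r ?subr_ge0//; have := sqr_ge0 (Num.sqrt (t + 1))^-1; nra.
Qed.

Lemma survival_bound_step (R : realType) (p : nat) (t q : R) :
  0 <= t -> 0 <= q <= 1 / 4 ->
  (1 - 2 * q) * survival_bound p.+1 t
    + q * (survival_bound p.+2 t + survival_bound p t)
  <= survival_bound p.+1 (t + q).
Proof.
move=> t0 /[dup] q14 /andP[q0 q4]; rewrite /survival_bound.
have s1 := sqrt_addr1_ge1 t0; have tq0 : 0 <= t + q by rewrite addr_ge0.
have s1' := sqrt_addr1_ge1 tq0.
have s2 : Num.sqrt (t + 1) ^+ 2 = t + 1 by rewrite sqr_sqrtr; lra.
have s2' : Num.sqrt (t + q + 1) ^+ 2 = t + q + 1 by rewrite sqr_sqrtr; lra.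
set s := Num.sqrt (t + 1) in s1 s2 *; set s' := Num.sqrt _ in s1' s2' *.
have s0 : 0 < s by lra. have s0' : 0 < s' by lra.
have ss' : s <= s' by rewrite ler_wsqrtr; lra.
have d01 : 0 < s^-1 <= 1 by rewrite invr_gt0 s0 invf_le1//.
have y_le : 1 - p.+1%:R / s' <= 1 - p.+1%:R / s
    + (1 - (1 - p.+1%:R / s)) * (q * s^-1 ^+ 2 / 2).
  rewrite subKr -subr_ge0.
  have -> : 1 - p.+1%:R / s + p.+1%:R / s * (q * s^-1 ^+ 2 / 2)
       - (1 - p.+1%:R / s') =
      p.+1%:R * (s'^-1 - s^-1 + s^-1 * (q * s^-1 ^+ 2 / 2)) by field; lra.
  apply: mulr_ge0 => //.
  have -> : s'^-1 - s^-1 + s^-1 * (q * s^-1 ^+ 2 / 2) =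
      (2 * s ^+ 3 - 2 * s ^+ 2 * s' + q * s') / (2 * s ^+ 3 * s').
    by field; lra.
  apply: divr_ge0; last by rewrite !mulr_ge0// ?exprn_ge0// ltW.
  have -> : q = s' ^+ 2 - s ^+ 2 by rewrite s2 s2'; ring.
  have -> : 2 * s ^+ 3 - 2 * s ^+ 2 * s' + (s' ^+ 2 - s ^+ 2) * s' =
      (s' - s) ^+ 2 * (s' + 2 * s) by ring.
  by rewrite mulr_ge0 ?sqr_ge0//; lra.
have x1 : 1 - p.+1%:R / s <= 1 by rewrite gerBl divr_ge0// ltW.
have := sqr_pos_part_step q14 d01 x1 y_le.
have -> : 1 - p.+1%:R / s - s^-1 = 1 - p.+2%:R / s by rewrite !mulrS; ring.
have -> : 1 - p.+1%:R / s + s^-1 = 1 - p%:R / s by rewrite !mulrS; ring.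
lra.
Qed.

(** * The residual of the inexact iteration *)

Lemma tauS (R : realType) (alpha : nat -> R) (n : nat) :
  tau alpha n.+1 = tau alpha n + alpha n.+1 * (1 - alpha n.+1).
Proof. by rewrite /tau big_nat_recr. Qed.

Lemma ler_tau (R : realType) (alpha : nat -> R) (m n : nat) :
  (forall n : nat, (1 <= n)%N -> 0 <= alpha n <= 1) ->
  (m <= n)%N -> tau alpha m <= tau alpha n.
Proof.
move=> alpha01; elim: n => [|n IHn]; first by rewrite leqn0 => /eqP ->.
rewrite leq_eqVlt ltnS => /predU1P[->//|/IHn /le_trans]; apply.
have /andP[a0 a1] := alpha01 n.+1 isT.
by rewrite tauS lerDl mulr_ge0// subr_ge0.
Qed.

Lemma tau_ge0 (R : realType) (alpha : nat -> R) (n : nat) :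
  (forall n : nat, (1 <= n)%N -> 0 <= alpha n <= 1) -> 0 <= tau alpha n.
Proof.
move=> alpha01; have := ler_tau alpha01 (leq0n n).
by rewrite {1}/tau big_geq.
Qed.

(** The nonasymptotic estimate, for arbitrary errors: the kappa term comes from
    the initial condition of the heat equation and each error contributes as a
    source switched on at time tau_k. *)
Lemma inexact_KM_residual_le (R : realType) (X : normedModType R)
    (C : set X) (T : X -> X) (alpha : nat -> R) (e x : nat -> X) (kappa : R) :
  nonexpansive_on C T ->
  (forall n : nat, (1 <= n)%N -> 0 <= alpha n <= 1) ->
  inexact_KM_iteration T alpha e x ->
  (forall n, C (x n)) -> (forall n, `|T (x n) - x 0%N| <= kappa) ->
  forall n, `|x n - T (x n)| <= 2 * kappa / Num.sqrt (tau alpha n + 1) +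
    \sum_(1 <= k < n.+1)
      4 * (alpha k * `|e k|) / Num.sqrt (tau alpha n - tau alpha k + 1).
Proof.
move=> T_nonexp alpha01 x_rec xC x_bd n.
have kappa0 : 0 <= kappa by exact: le_trans (normr_ge0 _) (x_bd 0%N).
have alpha_bnd k : 0 <= alpha k.+1 /\ 0 <= 1 - alpha k.+1.
  by have /andP[] := alpha01 k.+1 isT; rewrite subr_ge0.
pose eps k := alpha k * `|e k|.
have eps0 k : (1 <= k)%N -> 0 <= eps k.
  by move=> /alpha01/andP[? _]; rewrite mulr_ge0.
(* The superposition of the supersolutions issued from each source. *)
pose w m p := kappa * survival_bound p (tau alpha m) +
  \sum_(1 <= k < m.+1) 2 * eps k * survival_bound p (tau alpha m - tau alpha k).
have eps_sum_ge0 m (f : nat -> R) : (forall k, 0 <= f k) ->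
    0 <= \sum_(1 <= k < m.+1) 2 * eps k * f k.
  move=> f0; rewrite big_nat_cond sumr_ge0// => k; rewrite andbT => /andP[k1 _].
  by apply: mulr_ge0 => //; apply: mulr_ge0 => //; exact: eps0.
(* Both recursions come from expanding a single step of the iteration. *)
have step m y : `|x m.+1 - y| <= (1 - alpha m.+1) * `|x m - y|
    + alpha m.+1 * `|T (x m) - y| + eps m.+1.
  have [a0 a1] := alpha_bnd m.
  have -> : x m.+1 - y = (1 - alpha m.+1) *: (x m - y)
      + alpha m.+1 *: (T (x m) - y) + alpha m.+1 *: e m.+1.
    rewrite x_rec !scalerBr addrACA -opprD -scalerDl subrK scale1r scalerDr.
    by rewrite addrA [RHS]addrAC.
  rewrite (le_trans (ler_normD _ _))// normrZ (ger0_norm a0) lerD2r.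
  by rewrite (le_trans (ler_normD _ _))// !normrZ !ger0_norm.
have : `|x n - T (x n)| <= w n 1%N.
  apply: (@distance_recursion_le _ alpha eps (fun m n => `|x m - x n|)
    (fun m n => `|x m - T (x n)|) w kappa) => //.
  - by move=> m; rewrite subrr normr0.
  - move=> m k _; rewrite distrC (le_trans (step _ _))//.
    by rewrite (distrC (x k)) (distrC (T _)).
  - by move=> k; rewrite distrC.
  - move=> m k _; rewrite (le_trans (step _ _))// lerD2r lerD2l.
    by apply: ler_wpM2l; [case: (alpha_bnd m)|exact: T_nonexp].
  - move=> m; rewrite /w survival_bound0 mulr0 add0r.
    by apply: eps_sum_ge0 => k; rewrite survival_bound0.
  - move=> p; rewrite /w big_geq// addr0 /tau big_geq// survival_boundS_0.
    by rewrite mulr1.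
  - move=> m p; have [a0 a1] := alpha_bnd m.
    set q := alpha m.+1 * (1 - alpha m.+1).
    have q14 : 0 <= q <= 1 / 4.
      rewrite mulr_ge0//=; have := sqr_ge0 (alpha m.+1 - 1 / 2).
      by rewrite /q; lra.
    rewrite [w m.+1 p.+1]/w big_nat_recr//= subrr survival_boundS_0.
    rewrite mulr1 [leRHS]addrA lerD2r.
    have hw p' : w m p' = kappa * survival_bound p' (tau alpha m) +
        \sum_(1 <= k < m.+1)
          2 * eps k * survival_bound p' (tau alpha m - tau alpha k).
      by [].
    rewrite !hw.
    have -> : forall A B C D E F : R,
      (1 - 2 * q) * (kappa * A + D) + q * (kappa * B + E + (kappa * C + F)) =
      kappa * ((1 - 2 * q) * A + q * (B + C)) + ((1 - 2 * q) * D + q * (E + F)).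
      by move=> *; ring.
    apply: lerD.
      by rewrite ler_wpM2l// tauS survival_bound_step// tau_ge0.
    rewrite mulrDr !mulr_sumr -!big_split/=.
    rewrite big_nat_cond [leRHS]big_nat_cond; apply: ler_sum => k.
    rewrite andbT => /andP[k1 km].
    have -> : forall A B C E : R,
      (1 - 2 * q) * (E * A) + (q * (E * B) + q * (E * C)) =
      E * ((1 - 2 * q) * A + q * (B + C)).
      by move=> *; ring.
    apply: ler_wpM2l; first by apply: mulr_ge0 => //; exact: eps0.
    rewrite tauS [_ + _ - tau alpha k]addrAC.
    by rewrite survival_bound_step// subr_ge0 ler_tau.
move=> /le_trans; apply; rewrite /w; apply: lerD.
  rewrite -mulrA mulrCA; apply: ler_wpM2l => //.
  exact: survival_bound1_le (tau_ge0 _ alpha01).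
rewrite big_nat_cond [leRHS]big_nat_cond; apply: ler_sum => k.
rewrite andbT => /andP[k1 kn].
have -> : forall A B : R, 4 * A / B = 2 * A * (2 / B) by move=> A B; lra.
apply: ler_wpM2l; first by apply: mulr_ge0 => //; exact: eps0.
by rewrite survival_bound1_le// subr_ge0 ler_tau.
Qed.

(** * Estimates of the error sums *)

Lemma ler_sum_telescope (R : realType) (f F : nat -> R) (m n : nat) :
  (m <= n)%N -> (forall k, (m <= k < n)%N -> f k <= F k.+1 - F k) ->
  \sum_(m <= k < n) f k <= F n - F m.
Proof.
move=> mn fF; rewrite -telescope_sumr//.
rewrite big_nat_cond [leRHS]big_nat_cond; apply: ler_sum => k.
by rewrite andbT => /fF.
Qed.

Lemma sub_ln_ge (R : realType) (s t : R) : 0 < s -> s <= t ->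
  (t - s) / t <= ln t - ln s.
Proof.
move=> s0 st; have t0 : 0 < t by exact: lt_le_trans st.
rewrite -lerN2 opprB -ln_div ?posrE//.
have -> : - ((t - s) / t) = s / t - 1 by field; lra.
have {1}-> : s / t = 1 + (s / t - 1) by ring.
by rewrite le_ln1Dx// ltrBrDl addrN divr_gt0.
Qed.

(** A Bernoulli-type lower bound for the growth of powers, obtained from
    expR y >= 1 + y with y = b (ln t - ln s). *)
Lemma powR_increment (R : realType) (b s t : R) : 0 <= b -> 0 < s -> s <= t ->
  s `^ b * (1 + b * ((t - s) / t)) <= t `^ b.
Proof.
move=> b0 s0 st; have t0 : 0 < t by exact: lt_le_trans st.
rewrite /powR !gt_eqF//.
have -> : b * ln t = b * ln s + b * (ln t - ln s) by ring.
rewrite expRD ler_pM2l ?expR_gt0// (le_trans _ (expR_ge1Dx _))// lerD2l.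
by rewrite ler_wpM2l// sub_ln_ge.
Qed.

(** The next two lemmas compare (t - s) / t `^ a with the integral of the power
    u `^ (- a) between s and t, up to a constant factor. *)
Lemma div_powR_le_lt1 (R : realType) (a s t : R) :
  0 <= a < 1 -> 0 < s -> s <= t ->
  (t - s) / t `^ a <= 2 / (1 - a) * (t `^ (1 - a) - s `^ (1 - a)).
Proof.
move=> /andP[a0 a1] s0 st; have t0 : 0 < t by exact: lt_le_trans st.
have b0 : 0 < 1 - a by lra.
have := powR_increment (ltW b0) s0 st.
have {1}-> : t `^ a = t / t `^ (1 - a).
  rewrite powRB ?(lt0r_neq0 t0) ?implybT// powRr1 ?(ltW t0)//.
  by have := powR_gt0 a t0; move: (t `^ a) => A A0; field; lra.
have := powR_gt0 (1 - a) t0; have := powR_gt0 (1 - a) s0.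
move: (t `^ (1 - a)) (s `^ (1 - a)) => U V V0 U0.
have -> : (t - s) / (t / U) = U * ((t - s) / t) by field; lra.
set z := (t - s) / t => VU.
have z0 : 0 <= z by rewrite divr_ge0//; lra.
have z1 : z <= 1 by rewrite ler_pdivrMr//; lra.
rewrite -ler_pdivrMl ?divr_gt0//.
have -> : (2 / (1 - a))^-1 * (U * z) = U * ((1 - a) * z / 2) by field; lra.
set y := (1 - a) * z in VU *.
have y0 : 0 <= y by rewrite mulr_ge0// ltW.
have y1 : y <= 1 by rewrite /y; nra.
suff : V * (1 + y) <= U * (1 - y / 2) * (1 + y) by rewrite ler_pM2r; nra.
apply: (le_trans VU).
have -> : U * (1 - y / 2) * (1 + y) = U + U * (y * (1 - y) / 2) by field.
by rewrite lerDl mulr_ge0 ?(ltW U0)// divr_ge0// mulr_ge0// subr_ge0.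
Qed.

Lemma div_powR_le_gt1 (R : realType) (a s t : R) : 1 < a -> 0 < s -> s <= t ->
  (t - s) / t `^ a <= (a - 1)^-1 * ((s `^ (a - 1))^-1 - (t `^ (a - 1))^-1).
Proof.
move=> a1 s0 st; have t0 : 0 < t by exact: lt_le_trans st.
have b0 : 0 < a - 1 by lra.
have := powR_increment (ltW b0) s0 st.
have {1}-> : t `^ a = t * t `^ (a - 1) by rewrite mulr_powRB1 ?ltW//; lra.
have := powR_gt0 (a - 1) t0; have := powR_gt0 (a - 1) s0.
move: (t `^ (a - 1)) (s `^ (a - 1)) => U V V0 U0 VU.
rewrite ler_pdivlMl// -subr_ge0.
have -> : V^-1 - U^-1 - (a - 1) * ((t - s) / (t * U)) =
   (U - V * (1 + (a - 1) * ((t - s) / t))) / (U * V) by field; lra.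
by rewrite divr_ge0 ?subr_ge0// mulr_ge0// ltW.
Qed.

Lemma div_sqrt_le (R : realType) (r q : R) : 0 <= r -> 0 <= q <= 1 / 4 ->
  q / Num.sqrt (r + 1) <= 3 * (Num.sqrt (r + q + 1) - Num.sqrt (r + 1)).
Proof.
move=> r0 /andP[q0 q4].
have u1 := sqrt_addr1_ge1 r0.
have u2 : Num.sqrt (r + 1) ^+ 2 = r + 1 by rewrite sqr_sqrtr; lra.
have v2 : Num.sqrt (r + q + 1) ^+ 2 = r + q + 1 by rewrite sqr_sqrtr; lra.
have uv : Num.sqrt (r + 1) <= Num.sqrt (r + q + 1) by rewrite ler_wsqrtr; lra.
move: (Num.sqrt (r + 1)) (Num.sqrt (r + q + 1)) => u v in u1 u2 v2 uv *.
have qE : q = (v - u) * (v + u) by lra.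
rewrite ler_pdivrMr; last lra.
have v2u : v <= 2 * u by nra.
rewrite qE; nra.
Qed.

(** Each of the two terms on the right dominates on one side of t = s / 2. *)
Lemma powR_sqrt_le_split (R : realType) (a s t : R) :
  0 <= a -> 1 <= t -> t <= s ->
  (t `^ a * Num.sqrt (s - t + 1))^-1 <=
  2 / Num.sqrt s / t `^ a + 2 `^ a / s `^ a / Num.sqrt (s - t + 1).
Proof.
move=> a0 t1 ts; have t0 : 0 < t by lra. have s0 : 0 < s by lra.
have ta := powR_gt0 a t0; have sa := powR_gt0 a s0.
have p2 := powR_gt0 a (ltr0Sn R 1).
have r0 : 0 <= s - t by lra.
have r1 := sqrt_addr1_ge1 r0.
have sq0 : 0 < Num.sqrt s by rewrite sqrtr_gt0.
have [t2|t2] := leP t (s / 2).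
  rewrite -[leLHS]addr0; apply: lerD; last by rewrite !divr_ge0// ?ltW//; lra.
  rewrite invfM mulrC ler_wpM2r ?invr_ge0 ?(ltW ta)//.
  rewrite -invf_div lef_pV2 ?posrE ?divr_gt0//; last lra.
  rewrite ler_pdivrMr//.
  have : Num.sqrt s ^+ 2 = s by rewrite sqr_sqrtr// ltW.
  have : Num.sqrt (s - t + 1) ^+ 2 = s - t + 1 by rewrite sqr_sqrtr//; lra.
  move: (Num.sqrt s) (Num.sqrt (s - t + 1)) sq0 r1 => u v u0 v1 v2 u2; nra.
rewrite -[leLHS]add0r; apply: lerD; first by rewrite !divr_ge0// ltW.
rewrite invfM ler_wpM2r ?invr_ge0 ?sqrtr_ge0//.
rewrite ler_pdivlMr// mulrC ler_pdivrMr// -powRM//; last by rewrite ltW.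
by rewrite ge0_ler_powR// ?nnegrE; lra.
Qed.

Lemma convolution_le (R : realType) (alpha : nat -> R) (a : R) (N n : nat) :
  (forall n : nat, (1 <= n)%N -> 0 <= alpha n <= 1) -> 0 <= a ->
  1 <= tau alpha N -> (N <= n)%N ->
  \sum_(N <= k < n) (tau alpha k.+1 - tau alpha k) /
     (tau alpha k.+1 `^ a * Num.sqrt (tau alpha n - tau alpha k.+1 + 1)) <=
  2 / Num.sqrt (tau alpha n) *
    \sum_(N <= k < n) (tau alpha k.+1 - tau alpha k) / tau alpha k.+1 `^ a
  + 6 * 2 `^ a * tau alpha n `^ (1 / 2 - a).
Proof.
move=> alpha01 a0 tN Nn.
have tn : 1 <= tau alpha n by rewrite (le_trans tN)// ler_tau.
set s := tau alpha n in tn *.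
pose q k := tau alpha k.+1 - tau alpha k.
have q0 k : 0 <= q k by rewrite subr_ge0 ler_tau.
have q4 k : q k <= 1 / 4.
  by rewrite /q tauS addrC addKr; have := sqr_ge0 (alpha k.+1 - 1 / 2); lra.
apply: (@le_trans _ _ (\sum_(N <= k < n)
    (2 / Num.sqrt s * (q k / tau alpha k.+1 `^ a) +
     2 `^ a / s `^ a * (q k / Num.sqrt (s - tau alpha k.+1 + 1))))).
  rewrite big_nat_cond [leRHS]big_nat_cond; apply: ler_sum => k.
  rewrite andbT => /andP[Nk kn].
  have t1 : 1 <= tau alpha k.+1 by rewrite (le_trans tN)// ler_tau// ltnW.
  have ts : tau alpha k.+1 <= s by rewrite ler_tau.
  have := ler_wpM2l (q0 k) (powR_sqrt_le_split a0 t1 ts).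
  by rewrite mulrDr; rewrite /q; lra.
rewrite big_split/= -!mulr_sumr lerD2l.
have sum_le : \sum_(N <= k < n) q k / Num.sqrt (s - tau alpha k.+1 + 1)
    <= 3 * Num.sqrt (s + 1).
  apply: (@le_trans _ _ (- 3 * Num.sqrt (s - tau alpha n + 1)
      - (- 3 * Num.sqrt (s - tau alpha N + 1)))).
    apply: (@ler_sum_telescope _ _
        (fun k => - 3 * Num.sqrt (s - tau alpha k + 1))) => // k /andP[Nk kn].
    have r0 : 0 <= s - tau alpha k.+1 by rewrite subr_ge0 ler_tau.
    have q04 : 0 <= q k <= 1 / 4 by rewrite q0 q4.
    have := div_sqrt_le r0 q04.
    have -> : s - tau alpha k.+1 + q k + 1 = s - tau alpha k + 1.
      by rewrite /q; ring.
    lra.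
  have : Num.sqrt (s - tau alpha N + 1) <= Num.sqrt (s + 1).
    by rewrite ler_wsqrtr//; lra.
  have := sqrtr_ge0 (s - tau alpha n + 1); lra.
have s0 : 0 < s by lra.
have c0 : 0 <= 2 `^ a / s `^ a by rewrite divr_ge0 ?powR_ge0.
apply: (le_trans (ler_wpM2l c0 sum_le)).
have : Num.sqrt (s + 1) <= 2 * Num.sqrt s.
  have -> : 2 * Num.sqrt s = Num.sqrt (4 * s).
    have -> : 4 = 2 ^+ 2 :> R by ring.
    by rewrite sqrtrM ?sqrtr_sqr ?ger0_norm// exprn_ge0.
  by rewrite ler_wsqrtr//; lra.
have -> : s `^ (1 / 2 - a) = Num.sqrt s / s `^ a.
  by rewrite powRB ?(lt0r_neq0 s0) ?implybT// div1r powR12_sqrt// ltW.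
move: c0; move: (2 `^ a) (s `^ a) (Num.sqrt (s + 1)) (Num.sqrt s).
move=> A B U V c0 UV.
have -> : 6 * A * (V / B) = A / B * (3 * (2 * V)) by ring.
by rewrite ler_wpM2l// ler_wpM2l.
Qed.

(** * Rates of convergence *)

Lemma inexact_KM_residual_asymp (R : realType) (X : normedModType R)
    (C : set X) (T : X -> X) (alpha : nat -> R) (e x : nat -> X) (kappa a : R) :
  nonexpansive_on C T ->
  (forall n : nat, (1 <= n)%N -> 0 <= alpha n <= 1) ->
  inexact_KM_iteration T alpha e x ->
  (forall n, C (x n)) -> (forall n, `|T (x n) - x 0%N| <= kappa) ->
  tau alpha @ \oo --> +oo ->
  0 <= a ->
  (fun n => `|e n|) =O_\oo (fun n => (1 - alpha n) / tau alpha n `^ a) ->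
  exists K : R, 0 <= K /\ exists N, 1 <= tau alpha N /\
    forall n, (N <= n)%N -> `|x n - T (x n)| <=
      K / Num.sqrt (tau alpha n) * (1 + \sum_(N <= k < n)
         (tau alpha k.+1 - tau alpha k) / tau alpha k.+1 `^ a)
      + K * tau alpha n `^ (1 / 2 - a).
Proof.
move=> T_nonexp alpha01 x_rec xC x_bd tau_infty a0 /eqO_exP[M M0 eM].
have kappa0 : 0 <= kappa by exact: le_trans (normr_ge0 _) (x_bd 0%N).
move/cvgryPge : tau_infty => /(_ 1) tau_ge1.
have [N _ HN] := filterI eM tau_ge1.
have tN : 1 <= tau alpha N by have [] := HN N (leqnn N).
pose eps k := alpha k * `|e k|.
have eps0 k : 0 <= eps k.+1.
  by rewrite mulr_ge0//; have /andP[] := alpha01 k.+1 isT.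
have eps_le k : (N <= k)%N ->
    eps k.+1 <= M * ((tau alpha k.+1 - tau alpha k) / tau alpha k.+1 `^ a).
  move=> Nk; have [] := HN k.+1 (leqW Nk).
  have /andP[al0 al1] := alpha01 k.+1 isT.
  rewrite /= normr_id [X in _ <= _ * X -> _]ger0_norm; last first.
    by rewrite divr_ge0 ?powR_ge0// subr_ge0.
  move=> ek _.
  have -> : tau alpha k.+1 - tau alpha k = alpha k.+1 * (1 - alpha k.+1).
    by rewrite tauS addrC addKr.
  rewrite -[X in M * X]mulrA mulrCA.
  exact: ler_wpM2l.
(* No bound is assumed on the errors of index at most N; being finitely many,
   they contribute O(1 / sqrt (tau n)), because
   tau n <= (tau n - tau k + 1) * (tau k + 1). *)
pose K0 := \sum_(0 <= k < N) 4 * eps k.+1 * Num.sqrt (tau alpha k.+1 + 1).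
have K00 : 0 <= K0.
  by apply: sumr_ge0 => k _; rewrite mulr_ge0 ?sqrtr_ge0// mulr_ge0.
have p2 := powR_gt0 a (ltr0Sn R 1).
exists (2 * kappa + K0 + 8 * M + 24 * M * 2 `^ a); split.
  by rewrite !addr_ge0// !mulr_ge0// ltW.
exists N; split => // n Nn.
have tn : 1 <= tau alpha n by rewrite (le_trans tN)// ler_tau.
have sn0 : 0 < Num.sqrt (tau alpha n) by rewrite sqrtr_gt0; lra.
have sn1 : (Num.sqrt (tau alpha n + 1))^-1 <= (Num.sqrt (tau alpha n))^-1.
  by rewrite lef_pV2 ?posrE ?sqrtr_gt0 ?ler_wsqrtr//; lra.
set S := \sum_(N <= k < n) _; set P := _ `^ (1 / 2 - a).
have P0 : 0 <= P by exact: powR_ge0.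
have S0 : 0 <= S.
  by apply: sumr_ge0 => k _; rewrite divr_ge0 ?powR_ge0// subr_ge0 ler_tau.
apply: (le_trans (inexact_KM_residual_le T_nonexp alpha01 x_rec xC x_bd n)).
rewrite big_add1/= (big_cat_nat _ Nn)//=.
have init_le : \sum_(0 <= k < N) 4 * (alpha k.+1 * `|e k.+1|) /
    Num.sqrt (tau alpha n - tau alpha k.+1 + 1) <= K0 / Num.sqrt (tau alpha n).
  rewrite /K0 mulr_suml big_nat_cond [leRHS]big_nat_cond; apply: ler_sum => k.
  rewrite andbT => /andP[_ kN].
  rewrite -[leRHS]mulrA; apply: ler_wpM2l.
    by have := eps0 k; rewrite /eps; lra.
  apply: le_trans (ler_wpM2l (sqrtr_ge0 _) sn1).
  have tk0 := tau_ge0 k.+1 alpha01.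
  have tkn : tau alpha k.+1 <= tau alpha n by rewrite ler_tau// (leq_trans kN).
  rewrite ler_pdivlMr ?sqrtr_gt0; last lra.
  rewrite mulrC ler_pdivrMr ?sqrtr_gt0; last lra.
  rewrite -sqrtrM; last lra.
  by rewrite ler_wsqrtr//; nra.
have tail_le : \sum_(N <= k < n) 4 * (alpha k.+1 * `|e k.+1|) /
    Num.sqrt (tau alpha n - tau alpha k.+1 + 1) <=
    4 * M * (2 / Num.sqrt (tau alpha n) * S + 6 * 2 `^ a * P).
  have M4 : 0 <= 4 * M by rewrite mulr_ge0// ltW.
  apply: le_trans (ler_wpM2l M4 (convolution_le alpha01 a0 tN Nn)).
  rewrite mulr_sumr big_nat_cond [leRHS]big_nat_cond; apply: ler_sum => k.
  rewrite andbT => /andP[Nk kn].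
  set r := Num.sqrt _; set d := tau alpha k.+1 - _; set A := _ `^ a.
  have -> : 4 * M * (d / (A * r)) = 4 * (M * (d / A)) / r.
    by rewrite invfM; ring.
  rewrite ler_wpM2r ?invr_ge0 ?sqrtr_ge0// ler_wpM2l//.
  exact: eps_le.
have kap_le : 2 * kappa / Num.sqrt (tau alpha n + 1) <=
    2 * kappa * (Num.sqrt (tau alpha n))^-1.
  by rewrite ler_wpM2l// mulr_ge0.
move: kap_le init_le tail_le.
set u := (Num.sqrt (tau alpha n))^-1.
have u0 : 0 <= u by rewrite invr_ge0 ltW.
have uS : 0 <= u * S by rewrite mulr_ge0.
set c := 2 `^ a in p2 *.
move=> h1 h2 h3; apply: (le_trans (lerD h1 (lerD h2 h3))).
rewrite -subr_ge0.
have -> : (2 * kappa + K0 + 8 * M + 24 * M * c) * u * (1 + S) +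
  (2 * kappa + K0 + 8 * M + 24 * M * c) * P -
  (2 * kappa * u + (K0 * u + 4 * M * (2 * u * S + 6 * c * P))) =
  (8 * M + 24 * M * c) * u + (2 * kappa + K0 + 24 * M * c) * (u * S) +
  (2 * kappa + K0 + 8 * M) * P by ring.
have M0' := ltW M0; have p2' := ltW p2.
by rewrite !(addr_ge0, mulr_ge0).
Qed.

Theorem theorem3p4 (R : realType) (X : completeNormedModType R)
    (C : set X) (C_closed : closed C) (C_convex : convex_set C)
    (T : X -> X) (T_self : self_map_on C T) (T_nonexp : nonexpansive_on C T)
    (alpha : nat -> R)
    (alpha01 : forall n : nat, (1 <= n)%N -> 0 <= alpha n <= 1)
    (e : nat -> X) (x0 : X) (x0C : C x0)
    (x : nat -> X) (x_init : x 0%N = x0)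
    (x_rec : inexact_KM_iteration T alpha e x)
    (x_bounded : exists kappa : R, 0 <= kappa /\
       forall n : nat, C (x n) /\ `|T (x n) - x0| <= kappa)
    (tau_infty : tau alpha @ \oo --> +oo)
    (a : R)
    (e_bigO : (fun n : nat => `|e n|)
       =O_\oo (fun n : nat => (1 - alpha n) / tau alpha n `^ a)) :
  (1 / 2 <= a < 1 ->
     (fun n : nat => `|x n - T (x n)|)
       =O_\oo (fun n : nat => 1 / tau alpha n `^ (a - 1 / 2)))
  /\ (a = 1 ->
     (fun n : nat => `|x n - T (x n)|)
       =O_\oo (fun n : nat => ln (tau alpha n) / Num.sqrt (tau alpha n)))
  /\ (1 < a ->
     (fun n : nat => `|x n - T (x n)|)
       =O_\oo (fun n : nat => 1 / Num.sqrt (tau alpha n))).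
Proof.
have [kappa [_ xT]] := x_bounded.
have xC n : C (x n) by case: (xT n).
have x_bd n : `|T (x n) - x 0%N| <= kappa by rewrite x_init; case: (xT n).
have residual_asymp (a0 : 0 <= a) := inexact_KM_residual_asymp T_nonexp alpha01
  x_rec xC x_bd tau_infty a0 e_bigO.
have tau_mono n := ler_tau alpha01 (leqnSn n).
(* To exhibit a rate g, it is enough to bound the residual by a multiple of g
   along indices where tau n >= e, so that both tau n and ln (tau n) are at
   least 1. *)
have rate (g : nat -> R) (L : R) (N : nat) :
    (forall n, (N <= n)%N -> expR 1 <= tau alpha n ->
       `|x n - T (x n)| <= L * g n) ->
    (fun n => `|x n - T (x n)|) =O_\oo g.
  move=> Lg; apply/eqO_exP; exists (`|L| + 1); first by rewrite ltr_wpDl.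
  have /cvgryPge/(_ (expR 1)) tau_e := tau_infty.
  near=> n; rewrite normr_id (le_trans (Lg n _ _))//.
  - by near: n; exists N.
  - by near: n.
  - rewrite (le_trans (ler_norm _))// normrM ler_wpM2r// lerDl//.
have e1 : 1 <= expR 1 :> R by rewrite (le_trans _ (expR_ge1Dx _))//; lra.
split; [|split].
- move=> /andP[a_ge a_lt].
  have a0 : 0 <= a by lra.
  have [K [K0 [N [tN HN]]]] := residual_asymp a0.
  have tau_pos n : (N <= n)%N -> 0 < tau alpha n.
    by move=> Nn; have := ler_tau alpha01 Nn; lra.
  pose c := 2 / (1 - a).
  have c0 : 0 <= c by rewrite divr_ge0//; lra.
  apply: (rate _ (K * (1 + c) + K) N) => n Nn te.
  have tn1 : 1 <= tau alpha n by exact: le_trans te.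
  have tn := tau_pos n Nn.
  rewrite (le_trans (HN n Nn))//.
  have S_le : \sum_(N <= k < n) (tau alpha k.+1 - tau alpha k)
      / tau alpha k.+1 `^ a <= c * tau alpha n `^ (1 - a).
    pose F k := c * tau alpha k `^ (1 - a).
    rewrite (le_trans (ler_sum_telescope (F := F) Nn _))//.
      move=> k /andP[Nk kn]; rewrite /F -mulrBr.
      by apply: div_powR_le_lt1; rewrite ?tau_pos// a0.
    by rewrite gerBl /F mulr_ge0// powR_ge0.
  have one_le : 1 <= tau alpha n `^ (1 - a).
    by rewrite -[leLHS](powRr0 (tau alpha n)) ler_powR//; lra.
  have E1 : 1 / tau alpha n `^ (a - 1 / 2) = tau alpha n `^ (1 / 2 - a).
    by rewrite -[RHS]mul1r -powRN opprB.
  have E2 : tau alpha n `^ (1 - a) / Num.sqrt (tau alpha n)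
      = tau alpha n `^ (1 / 2 - a).
    rewrite -(powR12_sqrt (ltW tn)) -powRB ?(lt0r_neq0 tn) ?implybT//.
    by congr (_ `^ _); field.
  rewrite E1 mulrDl lerD2r -E2.
  have -> : K * (1 + c) * (tau alpha n `^ (1 - a) / Num.sqrt (tau alpha n)) =
     K / Num.sqrt (tau alpha n) * ((1 + c) * tau alpha n `^ (1 - a)) by ring.
  rewrite ler_wpM2l ?divr_ge0 ?sqrtr_ge0//.
  by rewrite mulrDl mul1r lerD.
- move=> a1.
  have a0 : 0 <= a by lra.
  have [K [K0 [N [tN HN]]]] := residual_asymp a0.
  have tau_pos n : (N <= n)%N -> 0 < tau alpha n.
    by move=> Nn; have := ler_tau alpha01 Nn; lra.
  apply: (rate _ (3 * K) N) => n Nn te.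
  have tn := tau_pos n Nn.
  rewrite (le_trans (HN n Nn))// a1.
  have S_le : \sum_(N <= k < n) (tau alpha k.+1 - tau alpha k)
      / tau alpha k.+1 `^ 1 <= ln (tau alpha n).
    pose F k := ln (tau alpha k).
    rewrite (le_trans (ler_sum_telescope (F := F) Nn _))//.
      move=> k /andP[Nk kn]; rewrite powRr1 ?tau_ge0//.
      by rewrite /F sub_ln_ge// tau_pos.
    by rewrite gerBl /F ln_ge0.
  have one_le : 1 <= ln (tau alpha n).
    by rewrite -[leLHS](expRK 1) ler_ln ?posrE ?expR_gt0.
  have -> : tau alpha n `^ (1 / 2 - 1) = (Num.sqrt (tau alpha n))^-1.
    by rewrite -(powR12_sqrt (ltW tn)) -powRN; congr (_ `^ _); field.
  have Ku : 0 <= K / Num.sqrt (tau alpha n) by rewrite divr_ge0 ?sqrtr_ge0.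
  have := ler_wpM2l Ku (lerD one_le S_le).
  have := ler_wpM2l Ku one_le.
  lra.
- move=> a1.
  have a0 : 0 <= a by lra.
  have [K [K0 [N [tN HN]]]] := residual_asymp a0.
  have tau_pos n : (N <= n)%N -> 0 < tau alpha n.
    by move=> Nn; have := ler_tau alpha01 Nn; lra.
  pose F k := - (a - 1)^-1 * (tau alpha k `^ (a - 1))^-1.
  apply: (rate _ (K * (1 - F N) + K) N) => n Nn te.
  have tn1 : 1 <= tau alpha n by exact: le_trans te.
  have tn := tau_pos n Nn.
  rewrite (le_trans (HN n Nn))//.
  have S_le : \sum_(N <= k < n) (tau alpha k.+1 - tau alpha k)
      / tau alpha k.+1 `^ a <= - F N.
    rewrite (le_trans (ler_sum_telescope (F := F) Nn _))//.
      move=> k /andP[Nk kn].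
      rewrite (le_trans (div_powR_le_gt1 a1 (tau_pos k Nk) (tau_mono k)))//.
      by rewrite /F; lra.
    by rewrite gerDr /F mulNr oppr_le0 mulr_ge0// invr_ge0 ?powR_ge0//; lra.
  have P_le : tau alpha n `^ (1 / 2 - a) <= (Num.sqrt (tau alpha n))^-1.
    by rewrite -(powR12_sqrt (ltW tn)) -powRN ler_powR//; lra.
  rewrite [1 / Num.sqrt _]div1r mulrDl; apply: lerD; last exact: ler_wpM2l.
  rewrite [leRHS]mulrAC ler_wpM2l ?divr_ge0 ?sqrtr_ge0//.
  by rewrite lerD2l.
Unshelve. all: by end_near.
Qed.
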